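(* The minimum side length of any planar straight-line orthogonal grid drawing of an $n$-node complete ternary tree is in $\Omega(n^{\log_3((1+\sqrt5)/2)})\subseteq\Omega(n^{0.438})$; that is, there is a constant $k>0$ such that for every $h\ge1$, every planar straight-line orthogonal grid drawing of $T_h$ has both width and height at least $k\cdot n^{\log_3((1+\sqrt5)/2)}$, where $n=(3^h-1)/2$.
   Context: $T_h$ denotes the complete ternary tree: every non-leaf node has exactly three children and every root-to-leaf path has exactly $h$ nodes; it has $(3^h-1)/2$ nodes. A planar straight-line orthogonal grid drawing maps nodes to distinct integer points and edges to horizontal or vertical segments, with no crossings. Its width (height) is the number of vertical (horizontal) grid lines intersecting it; the minimum side length is the minimum of width and height. *)

(* Defs.v *)
From HB Require Import structures.
From mathcomp Require Import all_boot all_order all_algebra.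
From mathcomp Require Import finmap.
From mathcomp Require Import all_classical all_reals all_analysis.

Set Implicit Arguments.
Unset Strict Implicit.
Unset Printing Implicit Defensive.

Import Order.TTheory GRing.Theory Num.Theory.
Import numFieldNormedType.Exports.

Local Open Scope classical_set_scope.
Local Open Scope ring_scope.

(* A node of T_h (h >= 1) is encoded by the sequence of child indices leading
   to it from the root [::]; root-to-leaf paths have h nodes, hence sequences
   have length at most h - 1.  The index h = 0 is a junk value. *)
Definition node (h : nat) := {bseq h.-1 of 'I_3}.

Definition is_parent (h : nat) (u v : node h) : bool :=
  [exists i : 'I_3, (v : seq 'I_3) == rcons u i].

Lemma card_node (h : nat) : (0 < h)%N -> #|{: node h}| = ((3 ^ h).-1./2)%N.
Proof.
case: h => // h _; rewrite card_bseq card_ord /= predn_exp mul2n doubleK.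
by apply: eq_bigr.
Qed.

Section Drawing.
Variables (R : realType) (h : nat).
Implicit Types D : node h -> int * int.

Definition to_plane (p : int * int) : R * R := (p.1%:~R, p.2%:~R).

Definition segment (p q : R * R) : set (R * R) :=
  [set z | exists2 t : R, 0 <= t <= 1 &
     z = ((1 - t) * p.1 + t * q.1, (1 - t) * p.2 + t * q.2)].

Definition edge_segment D (u v : node h) : set (R * R) :=
  segment (to_plane (D u)) (to_plane (D v)).

(* Two distinct edges may meet only at the image of a common end-node; this
   excludes crossings, overlaps, and edges running through other nodes (every
   node is the end of some edge as soon as there is an edge). *)
Definition noncrossing D : Prop :=
  forall u v u' v' : node h,
    is_parent u v -> is_parent u' v' -> (u, v) != (u', v') ->
    forall z, edge_segment D u v z -> edge_segment D u' v' z ->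
    exists w : node h,
      [/\ w \in [:: u; v], w \in [:: u'; v'] & z = to_plane (D w)].

Definition axis_parallel D : Prop :=
  forall u v : node h, is_parent u v ->
    (D u).1 = (D v).1 \/ (D u).2 = (D v).2.

Definition orthogonal_drawing D : Prop :=
  [/\ injective D, axis_parallel D & noncrossing D].

Definition drawing_points D : set (R * R) :=
  [set z | (exists u : node h, z = to_plane (D u)) \/
           (exists u v : node h, is_parent u v /\ edge_segment D u v z)].

(* The sets of grid lines below are finite since the tree is. *)
Definition width D : nat :=
  (#|` fset_set [set c : int | exists2 z, drawing_points D z & z.1 = c%:~R]|)%fset.

Definition height D : nat :=
  (#|` fset_set [set c : int | exists2 z, drawing_points D z & z.2 = c%:~R]|)%fset.

End Drawing.

Definition log (R : realType) (b x : R) : R := ln x / ln b.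

Definition golden_ratio (R : realType) : R := (1 + Num.sqrt 5) / 2.

(* Main.v *)
Require Import Defs.
From mathcomp Require Import all_boot all_order all_algebra.
From mathcomp Require Import all_classical all_reals all_analysis.
From mathcomp Require Import zify ring lra.

Set Implicit Arguments.
Unset Strict Implicit.
Unset Printing Implicit Defensive.

Import Order.TTheory GRing.Theory Num.Theory.
Import numFieldNormedType.Exports.

Local Open Scope classical_set_scope.
Local Open Scope ring_scope.

(** In an orthogonal drawing a non-root internal node has a neighbour in each of
    the four directions.  Let p -- q be a horizontal edge between a node p of
    height g and its child q, and assume that both have a child above them.  The
    horizontal line through the lower of these two children s, followed towards
    the column of the other one, meets a chain of descendants of s ending in a
    leaf, and this chain cannot get across the vertical edge from p or q to the
    higher child.  Hence the length f(g) of p -- q exceeds the sum of the lengths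
    of the edges of the chain, so that f(g) >= 1 + f(2) + ... + f(g-2), because s
    has height at least g-2; this is the Fibonacci recurrence.  A horizontal edge
    near the root then gives the width, and exchanging the axes the height. *)

(** * Fibonacci numbers and drawings in integer coordinates *)

Fixpoint fib (n : nat) : nat :=
  if n is n1.+1 then if n1 is n2.+1 then (fib n1 + fib n2)%N else 1%N else 0%N.

Lemma fibSS n : fib n.+2 = (fib n.+1 + fib n)%N.
Proof. by []. Qed.

Lemma fib_leS n : (fib n <= fib n.+1)%N.
Proof. by case: n => // n; rewrite fibSS leq_addr. Qed.

Definition between (a b c : int) : bool := (a <= c <= b) || (b <= c <= a).

(** For axis-aligned [p] and [q] the box degenerates to the grid points of the segment from [p] to
    [q]. *)
Definition in_box (p q z : int * int) : bool :=
  between p.1 q.1 z.1 && between p.2 q.2 z.2.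

(* Edges are indexed by their child end-node [rcons s i]. *)
Record grid_drawing (h : nat) (D : seq 'I_3 -> int * int) : Prop := GridDrawing {
  drawing_inj : forall s t,
    (size s < h)%N -> (size t < h)%N -> D s = D t -> s = t;
  drawing_axis : forall s i, (size (rcons s i) < h)%N ->
    (D s).1 = (D (rcons s i)).1 \/ (D s).2 = (D (rcons s i)).2;
  drawing_cross : forall s i t j z,
    (size (rcons s i) < h)%N -> (size (rcons t j) < h)%N ->
    rcons s i <> rcons t j ->
    in_box (D s) (D (rcons s i)) z -> in_box (D t) (D (rcons t j)) z ->
    exists w, [/\ w \in [:: s; rcons s i], w \in [:: t; rcons t j] & z = D w]
}.

(** One of four directions: the first bit says horizontal, the second says right or up. It is only
    meaningful for distinct aligned points. *)
Definition dir (p q : int * int) : bool * bool :=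
  if p.2 == q.2 then (true, p.1 < q.1) else (false, p.2 < q.2).

Definition step (d : bool * bool) (p : int * int) : int * int :=
  let e := (if d.2 then 1 else -1) in
  if d.1 then (p.1 + e, p.2) else (p.1, p.2 + e).

Lemma step_in_box p q : p != q -> p.1 = q.1 \/ p.2 = q.2 ->
  in_box p q (step (dir p q) p) && in_box q p (step (dir p q) p).
Proof.
case: p q => [a b] [c d]; rewrite /dir /step /in_box /between /= xpair_eqE.
case: (eqVneq b d) => [->|bd] /=; [case: (ltrP a c)|case: (ltrP b d)] => /=; lia.
Qed.

Lemma step_neq d p : step d p <> p.
Proof. by case: d p => [[] []] [a b]; rewrite /step /= => -[]; lia. Qed.

Lemma dir_down p q : q.2 < p.2 -> dir p q = (false, false).
Proof. by rewrite /dir => qp; rewrite gt_eqF // ltNge ltW. Qed.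

Lemma rcons_neq (T : Type) (s : seq T) x : rcons s x <> s.
Proof. by move=> /(congr1 size); rewrite size_rcons; lia. Qed.

(** * Directions of the edges around a node *)

Section Grid.
Variables (h : nat) (D : seq 'I_3 -> int * int).
Hypothesis dD : grid_drawing h D.

Lemma edge_neq s i : (size (rcons s i) < h)%N -> D s != D (rcons s i).
Proof.
move=> hs; apply/eqP => /(drawing_inj dD) E; apply: (@rcons_neq _ s i).
by rewrite -E // (leq_trans _ hs) // size_rcons.
Qed.

(** Two edges leaving [s] in one direction share the grid point next to [D s], whereas noncrossing
    only lets them share [D s] itself. *)
Lemma child_dir_inj s i j : (size (rcons s i) < h)%N ->
  dir (D s) (D (rcons s i)) = dir (D s) (D (rcons s j)) -> i = j.
Proof.
move=> hi E; apply: contrapT => ij.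
have hj : (size (rcons s j) < h)%N by move: hi; rewrite !size_rcons.
have /andP[bi _] := step_in_box (edge_neq hi) (drawing_axis dD hi).
have /andP[bj _] := step_in_box (edge_neq hj) (drawing_axis dD hj).
rewrite -E in bj.
have [|w [wi wj zw]] := drawing_cross dD hi hj _ bi bj.
  by move/rcons_inj => -[].
have ws : w = s.
  move: wi wj; rewrite !inE => /orP[/eqP//|/eqP->] /orP[/eqP//|/eqP].
  by move/rcons_inj => -[].
by rewrite ws in zw; apply: (step_neq zw).
Qed.

Lemma child_parent_dir_neq r j i : (size (rcons (rcons r j) i) < h)%N ->
  dir (D (rcons r j)) (D (rcons (rcons r j) i)) <> dir (D (rcons r j)) (D r).
Proof.
set s := rcons r j => hi E.
have hs : (size s < h)%N by move: hi; rewrite !size_rcons; lia.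
have /andP[bi _] := step_in_box (edge_neq hi) (drawing_axis dD hi).
have : D s != D r by rewrite eq_sym edge_neq.
have ax : (D s).1 = (D r).1 \/ (D s).2 = (D r).2.
  by have [->|->] := drawing_axis dD hs; [left|right].
move=> /step_in_box/(_ ax)/andP[_ br].
rewrite -E in br.
have [|w [wi wj zw]] := drawing_cross dD hi hs _ bi br.
  exact: rcons_neq.
have ws : w = s.
  move: wi wj; rewrite !inE => /orP[/eqP//|/eqP->] /orP[/eqP|/eqP//].
  by move=> /(congr1 size); rewrite !size_rcons; lia.
by rewrite ws in zw; apply: (step_neq zw).
Qed.

(** The parent ([None]) and the three children take pairwise distinct directions, and there are only
    four, so each direction is taken. *)
Lemma child_in_dir r j d : ((size (rcons r j)).+1 < h)%N ->
  dir (D (rcons r j)) (D r) != d ->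
  exists i, dir (D (rcons r j)) (D (rcons (rcons r j) i)) = d.
Proof.
set s := rcons r j => hs nd.
pose f (o : option 'I_3) := dir (D s) (D (if o is Some i then rcons s i else r)).
have hi i : (size (rcons s i) < h)%N by rewrite size_rcons.
have f_inj : injective f.
  move=> [i|] [i'|] //; rewrite /f.
  - by move/(child_dir_inj (hi i)) ->.
  - by move/(child_parent_dir_neq (hi i)).
  - by move/esym/(child_parent_dir_neq (hi i')).
have [g _ fg] : bijective f.
  by apply: inj_card_bij => //; rewrite card_option card_ord card_prod card_bool.
move: (fg d) nd; rewrite /f; case: (g d) => [i Ei _|->]; last by rewrite eqxx.
by exists i.
Qed.

(** The root has no parent to count, but three children cannot fit into the two vertical
    directions. *)
Lemma root_horizontal_child : (1 < h)%N -> exists i, (D [::]).2 = (D [:: i]).2.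
Proof.
move=> h1; apply: contrapT => /forallNP nH.
have f_inj : injective (fun i : 'I_3 => (D [::]).2 < (D [:: i]).2).
  move=> i j E; apply: (@child_dir_inj [::]) => //=; rewrite /dir.
  by have /eqP/negbTE -> := nH i; have /eqP/negbTE -> := nH j; rewrite E.
by have := leq_card _ f_inj; rewrite card_ord card_bool.
Qed.

Lemma up_child r j : ((size (rcons r j)).+1 < h)%N ->
  dir (D (rcons r j)) (D r) != (false, true) ->
  exists i, (D (rcons (rcons r j) i)).1 = (D (rcons r j)).1 /\
            (D (rcons r j)).2 < (D (rcons (rcons r j) i)).2.
Proof.
move=> hs /(child_in_dir hs)[i Ei]; exists i; move: Ei; rewrite /dir.
have [//|->] : (D (rcons r j)).1 = (D (rcons (rcons r j) i)).1 \/
               (D (rcons r j)).2 = (D (rcons (rcons r j) i)).2.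
  by apply: (drawing_axis dD); rewrite size_rcons.
  by case: eqP => // _ -> [].
by rewrite eqxx.
Qed.

Lemma side_child r j e : ((size (rcons r j)).+1 < h)%N ->
  dir (D (rcons r j)) (D r) != (true, e) ->
  exists i, (D (rcons (rcons r j) i)).2 = (D (rcons r j)).2 /\
            ((D (rcons r j)).1 < (D (rcons (rcons r j) i)).1) = e.
Proof.
move=> hs /(child_in_dir hs)[i Ei]; exists i; move: Ei; rewrite /dir.
by case: eqP => // <- [].
Qed.

(** * Horizontal chains and the Fibonacci bound on edge lengths *)

(** Otherwise the two edges would meet at [((D u).1, (D s).2)], which would have to be a common
    end-node. The strict inequality excludes [u]; its child [rcons u i] cannot belong to both
    edges. *)
Lemma blocked_step s k u i :
  (size (rcons s k) < h)%N -> (size (rcons u i) < h)%N ->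
  (D u).1 = (D (rcons u i)).1 ->
  (D u).2 < (D s).2 <= (D (rcons u i)).2 ->
  (D s).2 = (D (rcons s k)).2 -> (D s).1 != (D u).1 ->
  ~~ between (D s).1 (D (rcons s k)).1 (D u).1.
Proof.
move=> hs hu ux uy sy sx; apply/negP => b.
have ne : rcons s k <> rcons u i.
  by move=> /rcons_inj[us _]; move: sx; rewrite us eqxx.
have [||w [ws wu zw]] := @drawing_cross _ _ dD _ _ _ _ ((D u).1, (D s).2) hs hu ne.
- by rewrite /in_box b /= -sy /between lexx.
- by rewrite /in_box -ux /between lexx /=; lia.
move: ws wu; rewrite !inE => /orP[/eqP|/eqP] ws; subst w.
  by move: sx; rewrite -zw eqxx.
move=> /orP[/eqP|/eqP] // E.
by move: uy sy; rewrite E; lia.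
Qed.

(* Mutual induction: the first part bounds the length of a horizontal edge, the
   second one the room that a horizontal chain starting at a node of height [m]
   needs in front of the vertical edge [u -- rcons u i]. *)
Lemma gap_lower_bound m :
  (forall r j i, (size (rcons r j) + m = h)%N -> (1 < m)%N ->
     dir (D (rcons r j)) (D r) != (false, true) ->
     (D (rcons r j)).2 = (D (rcons (rcons r j) i)).2 ->
     (fib m.-1)%:Z <= `|(D (rcons r j)).1 - (D (rcons (rcons r j) i)).1|) /\
  (forall r j u i e, (size (rcons r j) + m = h)%N -> (0 < m)%N ->
     dir (D (rcons r j)) (D r) != (false, true) ->
     dir (D (rcons r j)) (D r) != (true, e) ->
     (size (rcons u i) < h)%N -> (D u).1 = (D (rcons u i)).1 ->
     (D u).2 < (D (rcons r j)).2 <= (D (rcons u i)).2 ->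
     (D (rcons r j)).1 != (D u).1 -> ((D (rcons r j)).1 < (D u).1) = e ->
     (fib m.+1)%:Z <= `|(D (rcons r j)).1 - (D u).1|).
Proof.
elim/ltn_ind: m => m IH.
have edge_gap r j i : (size (rcons r j) + m = h)%N -> (1 < m)%N ->
     dir (D (rcons r j)) (D r) != (false, true) ->
     (D (rcons r j)).2 = (D (rcons (rcons r j) i)).2 ->
     (fib m.-1)%:Z <= `|(D (rcons r j)).1 - (D (rcons (rcons r j) i)).1|.
  set p := rcons r j; set q := rcons p i => hm m1 np py.
  have sq : size q = (size p).+1 by rewrite size_rcons.
  have hq : (size q < h)%N by lia.
  have pqx : (D p).1 != (D q).1.
    apply/eqP => px; have := edge_neq hq.
    by case: (D p) (D q) px py => [a b] [c d] /= -> ->; rewrite eqxx.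
  (* When [q] is a leaf the bound is [fib 1 = 1], which distinct columns provide. *)
  have [m2|m3] := leqP m 2.
    by have -> : m = 2%N by [lia]; rewrite [X in X%:Z]/=; lia.
  have [|a [ax ay]] := up_child _ np; first by rewrite -/p; lia.
  have [||b [bx b_y]] := @up_child p i.
  - by rewrite -/q; lia.
  - by rewrite -/q /dir py eqxx.
  rewrite -/p -/q in ax ay bx b_y.
  (* The chain starts at the lower child: that of [q] has height [m.-2] and gives exactly
     [fib m.-1], that of [p] has height [m.-1] and gives the larger [fib m]. *)
  have [le_ba|lt_ab] := lerP (D (rcons q b)).2 (D (rcons p a)).2.
  - have [|_ chain] := IH (m.-2); first by lia.
    have := chain q b p a ((D q).1 < (D p).1).
    rewrite bx ax -/p -/q.
    have -> : m.-2.+1 = m.-1 by lia.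
    rewrite distrC; apply => //.
    + by rewrite size_rcons; lia.
    + by lia.
    + by rewrite (dir_down b_y).
    + by rewrite (dir_down b_y).
    + by rewrite size_rcons; lia.
    + by rewrite py b_y le_ba.
    + by rewrite eq_sym.
  - have [|_ chain] := IH (m.-1); first by lia.
    have := chain p a q b ((D p).1 < (D q).1).
    rewrite bx ax -/p -/q.
    have -> : m.-1.+1 = m by lia.
    move=> C; apply: le_trans (C _ _ _ _ _ _ _ _ _) => //.
    + by rewrite -{2}(ltn_predK m1) lez_nat fib_leS.
    + by rewrite size_rcons; lia.
    + by lia.
    + by rewrite (dir_down ay).
    + by rewrite (dir_down ay).
    + by rewrite size_rcons; lia.
    + by rewrite -py ay ltW.
split => // r j u i e; set s := rcons r j => hm m0 nup ne hu ux uy sx se.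
have [m1|m1] := leqP m 1; first by have -> : m = 1%N by [lia]; rewrite /=; lia.
(* The chain continues with the child towards the column of [u]. This edge takes [fib m.-1] by the
   first part at the same [m]; the rest of the chain, by induction at [m.-1], takes [fib m]. *)
have [|k [ky kx]] := side_child _ ne; first by rewrite -/s; lia.
rewrite -/s in ky kx.
have hk : (size (rcons s k) < h)%N by rewrite size_rcons; lia.
have nb := blocked_step hk hu ux uy (esym ky) sx.
have := @edge_gap r j k hm m1 nup (esym ky); rewrite -/s.
have skx : (D s).1 != (D (rcons s k)).1.
  apply/eqP => E; have := edge_neq hk.
  by case: (D s) (D (rcons s k)) E ky => [a b] [c d] /= -> ->; rewrite eqxx.
have [|_ chain] := IH (m.-1); first by lia.
have : (fib m)%:Z <= `|(D (rcons s k)).1 - (D u).1|.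
  have -> : m = m.-1.+1 by lia.
  apply: (chain s k u i e) => //; rewrite ?ky //.
  - by rewrite size_rcons; lia.
  - by lia.
  - by rewrite /dir ky eqxx.
  - rewrite /dir ky eqxx; apply/eqP => -[]; lia.
  - by move: nb; rewrite /between; lia.
  - by move: nb; rewrite /between; lia.
have -> : fib m.+1 = (fib m + fib m.-1)%N by rewrite -{1 2}(ltn_predK m1).
by move: nb kx se sx skx; rewrite /between PoszD; lia.
Qed.

(** The gap bound requires the upper end of the edge to have a parent, so a root edge will not do.
    The child [j] beside the root continues horizontally on the side opposite to the root, and has
    height [h.-1]. *)
Lemma horizontal_edge_fib : (2 < h)%N -> exists s i,
  [/\ (size (rcons s i) < h)%N, (D s).2 = (D (rcons s i)).2 &
      (fib h.-2)%:Z <= `|(D s).1 - (D (rcons s i)).1|].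
Proof.
move=> h2; have [|j Ej] := root_horizontal_child; first exact: ltnW.
have dh : dir (D [:: j]) (D [::]) = (true, (D [:: j]).1 < (D [::]).1).
  by rewrite /dir Ej eqxx.
have [||i [iy ix]] := @side_child [::] j (~~ ((D [:: j]).1 < (D [::]).1)) => //.
  by rewrite dh; case: (_ < _).
exists [:: j], i; split => //.
have [+ _] := gap_lower_bound h.-1; move/(_ [::] j i); apply => //=.
- by lia.
- by lia.
- by rewrite dh.
Qed.

End Grid.

(** * From real segments to integer boxes *)

Lemma between_convex (R : realType) (a b c : int) : between a b c ->
  exists2 t : R, 0 <= t <= 1 & c%:~R = (1 - t) * a%:~R + t * b%:~R.
Proof.
move=> h; have [ab|ab] := eqVneq a b.
  exists 0; first by rewrite lexx ler01.
  have -> : c = a by move: h; rewrite /between; lia.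
  by rewrite subr0 mul1r mul0r addr0.
have d0 : b%:~R - a%:~R != 0 :> R by rewrite -intrB intr_eq0 subr_eq0 eq_sym.
exists ((c%:~R - a%:~R) / (b%:~R - a%:~R)); last by field.
move: h; rewrite /between => /orP[] /andP[h1 h2].
- have ba : 0 < b%:~R - a%:~R :> R by rewrite -intrB ltr0z; lia.
  rewrite divr_ge0 ?(ltW ba) ?subr_ge0 ?ler_int //=.
  by rewrite ler_pdivrMr // mul1r lerB // ler_int.
- have ba : 0 < a%:~R - b%:~R :> R by rewrite -intrB ltr0z; lia.
  rewrite -(opprB a%:~R) -(opprB a%:~R b%:~R) invrN mulrNN.
  rewrite divr_ge0 ?(ltW ba) ?subr_ge0 ?ler_int //=.
  by rewrite ler_pdivrMr // mul1r lerB // ler_int.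
Qed.

Lemma in_box_segment (R : realType) (p q z : int * int) :
  p.1 = q.1 \/ p.2 = q.2 -> in_box p q z ->
  segment (to_plane R p) (to_plane R q) (to_plane R z).
Proof.
case: p q z => [p1 p2] [q1 q2] [z1 z2]; rewrite /in_box /= => ax /andP[b1 b2].
have /orP[/eqP E|/eqP E] : (p1 == q1) || (p2 == q2).
- by case: ax => ->; rewrite eqxx ?orbT.
- subst q1; have [t t01 zt] := @between_convex R _ _ _ b2.
  have z1E : z1 = p1 by move: b1; rewrite /between; lia.
  by exists t => //=; rewrite /to_plane /= zt z1E -mulrDl subrK mul1r.
- subst q2; have [t t01 zt] := @between_convex R _ _ _ b1.
  have z2E : z2 = p2 by move: b2; rewrite /between; lia.
  by exists t => //=; rewrite /to_plane /= zt z2E -mulrDl subrK mul1r.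
Qed.

Lemma to_plane_inj (R : realType) : injective (to_plane R).
Proof. by move=> [a b] [c d] [] /intr_inj-> /intr_inj->. Qed.

(** Extending to all sequences lets children be formed by plain [rcons]. Sequences that are too long
    get a default value, which the size conditions of [grid_drawing] exclude. *)
Definition seq_drawing h (D : node h -> int * int) (s : seq 'I_3) : int * int :=
  D (insub_bseq h.-1 s).

Lemma insub_nodeK h (s : seq 'I_3) : (size s < h)%N ->
  insub_bseq h.-1 s = s :> seq 'I_3.
Proof. by case: h => // h; rewrite ltnS => hs; rewrite /insub_bseq val_insubd hs. Qed.

Lemma is_parent_rcons h (s : seq 'I_3) i : (size (rcons s i) < h)%N ->
  is_parent (insub_bseq h.-1 s : node h) (insub_bseq h.-1 (rcons s i)).
Proof.
move=> hs; apply/existsP; exists i; rewrite !insub_nodeK //.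
by move: hs; rewrite size_rcons; apply: ltnW.
Qed.

Lemma seq_drawing_grid (R : realType) h (D : node h -> int * int) :
  orthogonal_drawing R D -> grid_drawing h (seq_drawing D).
Proof.
move=> [Dinj Dax Dcr]; split.
- move=> s t hs ht /Dinj /(congr1 val).
  by rewrite /= !insub_nodeK.
- by move=> s i hs; apply/Dax/is_parent_rcons.
- move=> s i t j z hs ht ne bs bt.
  have hs' : (size s < h)%N by move: hs; rewrite size_rcons; apply: ltnW.
  have ht' : (size t < h)%N by move: ht; rewrite size_rcons; apply: ltnW.
  have ps := is_parent_rcons hs; have pt := is_parent_rcons ht.
  have [|||w [ws wt zw]] := Dcr _ _ _ _ ps pt _ (to_plane R z).
  + apply/eqP => -[_ /(congr1 val)]; rewrite /= !insub_nodeK //.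
  + by apply: in_box_segment bs; apply: Dax.
  + by apply: in_box_segment bt; apply: Dax.
  have wE x : (size x < h)%N -> (w == insub_bseq h.-1 x) = (val w == x).
    by move=> hx; rewrite -val_eqE /= insub_nodeK.
  exists (val w); split.
  + by move: ws; rewrite !inE !wE.
  + by move: wt; rewrite !inE !wE.
  + rewrite (to_plane_inj zw) /seq_drawing; congr D; apply/val_inj => /=.
    by rewrite insub_nodeK //; apply: leq_ltn_trans (size_bseq w) _; lia.
Qed.

(** * Width and height *)

Definition transpose (T : Type) (f : T -> int * int) (u : T) : int * int :=
  ((f u).2, (f u).1).

Lemma grid_drawing_transpose h D :
  grid_drawing h D -> grid_drawing h (transpose D).
Proof.
move=> [Di Da Dc]; split.
- move=> s t hs ht [E1 E2]; apply: Di => //.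
  by case: (D s) (D t) E1 E2 => [? ?] [? ?] /= -> ->.
- by move=> s i /Da[]; [right|left].
- move=> s i t j [z1 z2] hs ht ne.
  rewrite /in_box /= andbC => bs; rewrite andbC => bt.
  have [w [ws wt zw]] := Dc s i t j (z2, z1) hs ht ne bs bt.
  by exists w; split => //; rewrite /transpose -zw.
Qed.

Lemma height_transpose (R : realType) h (D : node h -> int * int) :
  height R D = width R (transpose D).
Proof.
have swap (E : node h -> int * int) z1 z2 :
    drawing_points E (z1, z2) -> drawing_points (R := R) (transpose E) (z2, z1).
  move=> [[u [-> ->]]|[u [v [uv [t t01 [-> ->]]]]]]; first by left; exists u.
  by right; exists u, v; split => //; exists t.
rewrite /height /width; congr (size (_ (fset_set _))).
apply/seteqP; split => c [[z1 z2] Dz /= zc].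
- by exists (z2, z1) => //; apply: swap.
- exists (z2, z1) => //=; have := swap _ _ _ Dz.
  have -> // : transpose (transpose D) = D.
  by apply/funext => u; rewrite /transpose /= -surjective_pairing.
Qed.

(** Needed because [fset_set] sends infinite sets to the empty one. Edge points are convex
    combinations of nodes, so every abscissa stays within [B] of 0. *)
Lemma finite_columns (R : realType) h (D : node h -> int * int) :
  finite_set [set c : int | exists2 z : R * R, drawing_points D z & z.1 = c%:~R].
Proof.
pose B := (\sum_u `|(D u).1|)%N.
have DB u : - (B%:Z%:~R : R) <= (D u).1%:~R <= (B%:Z%:~R : R).
  have : (`|(D u).1| <= B)%N by rewrite /B (bigD1 u) //= leq_addr.
  by rewrite -intrN !ler_int; lia.
pose s : seq int := [seq k%:Z - B%:Z | k <- iota 0 (B + B).+1].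
apply: (@sub_finite_set _ _ [set` s]); last exact: finite_seq.
move=> c [z Dz zc].
have : - (B%:Z%:~R : R) <= z.1 <= (B%:Z%:~R : R).
  case: Dz => [[u ->]|[u [v [_ [t /andP[t0 t1] ->]]]]] /=; first exact: DB.
  have /andP[u0 u1] := DB u; have /andP[v0 v1] := DB v.
  move: (_%:~R) (_%:~R) (_%:~R) u0 u1 v0 v1 => b x y u0 u1 v0 v1.
  apply/andP; split; nra.
rewrite zc -intrN !ler_int => cB.
rewrite /mkset; apply/mapP; exists `|(c + B%:Z)%R|%N; last by lia.
by rewrite mem_iota; lia.
Qed.

Lemma width_ge_size (R : realType) h (D : node h -> int * int) (s : seq int) :
  uniq s ->
  {in s, forall c, exists2 z : R * R, drawing_points D z & z.1 = c%:~R} ->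
  (size s <= width R D)%N.
Proof.
move=> us sD; apply: uniq_leq_size => // c cs.
by rewrite in_fset_set; [apply/mem_set/sD | exact: finite_columns].
Qed.

Lemma width_gt0 (R : realType) h (D : node h -> int * int) : (0 < width R D)%N.
Proof.
apply: (@width_ge_size _ _ _ [:: (D (insub_bseq _ [::])).1]) => // c.
rewrite inE => /eqP->; exists (to_plane R (D (insub_bseq _ [::]))) => //.
by left; exists (insub_bseq _ [::]).
Qed.

Lemma horizontal_edge_le_width (R : realType) h (D : node h -> int * int) u v :
  is_parent u v -> (D u).2 = (D v).2 ->
  (`|((D u).1 - (D v).1)%R| <= width R D)%N.
Proof.
move=> uv y; set n := `|_|%N.
(* An edge of length [n] meets [n + 1] columns; the first [n] from its left end are enough. *)
rewrite -[n](size_iota 0) -(size_map (fun k => k%:Z + Num.min (D u).1 (D v).1)).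
apply: width_ge_size; first by rewrite map_inj_uniq ?iota_uniq // => i j; lia.
move=> c /mapP[k]; rewrite mem_iota => kn ck.
exists (to_plane R (c, (D u).2)) => //; right; exists u, v; split => //.
apply: in_box_segment; first by right.
by rewrite /in_box /between /= -y lexx andbT; lia.
Qed.

Lemma fib_le_width (R : realType) h (D : node h -> int * int) :
  (2 < h)%N -> grid_drawing h (seq_drawing D) -> (fib h.-2 <= width R D)%N.
Proof.
move=> h2 /horizontal_edge_fib /(_ h2)[s [i [hs y gap]]].
have := @horizontal_edge_le_width R h D _ _ (is_parent_rcons hs) y.
by apply: leq_trans; rewrite -lez_nat abszE.
Qed.

(** * The golden ratio, Fibonacci growth and the exponent *)

Section Golden.
Variable R : realType.
Local Notation phi := (golden_ratio R).

Let sqrt5 : Num.sqrt (5 : R) * Num.sqrt 5 = 5 /\ 0 <= Num.sqrt (5 : R).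
Proof. by rewrite -expr2 sqr_sqrtr ?sqrtr_ge0. Qed.

Lemma sqr_golden_ratio : phi ^+ 2 = phi + 1.
Proof.
rewrite /golden_ratio expr2; case: sqrt5; move: (Num.sqrt _) => s; lra.
Qed.

(** A quotient of consecutive Fibonacci numbers, that is, a convergent of [phi] from below; it is
    precise enough for the comparison with [3 ^+ 53]. *)
Lemma golden_ratio_ge : 987 / 610 <= phi.
Proof. rewrite /golden_ratio; case: sqrt5; move: (Num.sqrt _) => s; nra. Qed.

Lemma golden_ratio_exp_fib n : phi ^+ n.+1 = (fib n.+1)%:R * phi + (fib n)%:R.
Proof.
elim: n => [|n IHn]; first by rewrite expr1 /= mul1r addr0.
rewrite exprS IHn fibSS natrD mulrDr mulrCA -expr2 sqr_golden_ratio.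
by rewrite mulrDr mulr1 mulrDl (mulrC phi); lra.
Qed.

Lemma golden_ratio_exp_le_fib n : phi ^+ n <= phi ^+ 2 * (fib n.+1)%:R.
Proof.
have g := golden_ratio_ge.
have F : phi ^+ n.+1 <= phi ^+ 3 * (fib n.+1)%:R.
  rewrite golden_ratio_exp_fib (exprS _ 2) sqr_golden_ratio.
  rewrite mulrDr mulr1 -expr2 sqr_golden_ratio.
  have : (fib n)%:R <= (fib n.+1)%:R :> R by rewrite ler_nat fib_leS.
  move: (fib n)%:R (fib n.+1)%:R (ler0n R (fib n.+1)) => a b b0 ab.
  nra.
by move: F; rewrite exprS (exprS _ 2) -mulrA ler_pM2l //; lra.
Qed.

(* 53 / 121 = 0.43801... is the simplest fraction between 0.438 and log_3 phi.
   The powers of b = phi ^ 11 / 3 ^ 5 stay near 1, which keeps the numerals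
   small. *)
Lemma exp3_le_golden_ratio : 3 ^+ 53 <= phi ^+ 121.
Proof.
have g := golden_ratio_ge.
have e11 : phi ^+ 11 = 89 * phi + 55 by rewrite golden_ratio_exp_fib.
pose b := phi ^+ 11 / 3 ^+ 5.
have b1 : 389 / 475 <= b by rewrite /b e11; lra.
have bE : phi ^+ 121 = b ^+ 11 * 3 ^+ 55.
  have n3 : 3 ^+ 5 != 0 :> R by rewrite expf_neq0 // pnatr_eq0.
  rewrite /b (exprM phi 11 11) (exprM 3 5 11) (expr_div_n (phi ^+ 11)).
  by rewrite divfK // expf_neq0.
rewrite {}bE; move: b b1 => b b1 {e11 g}.
have b2 : 279 / 416 <= b ^+ 2 by rewrite expr2; nra.
have b4 : 112 / 249 <= b ^+ 4 by rewrite (exprM b 2 2) expr2; nra.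
have b5 : 326 / 885 <= b ^+ 5 by rewrite exprS; nra.
(* The powers of [b] are bounded below along the chain 1, 2, 4, 5, 10, 11 by fractions with small
   terms. *)
have b10 : 119 / 877 <= b ^+ 10 by rewrite (exprM b 5 2) expr2; nra.
have b11 : 1 / 9 <= b ^+ 11 by rewrite exprS; nra.
(* The spare factor [3 ^+ 2] makes up for [b ^+ 11], which is at least [1 / 9]. *)
by rewrite (exprD _ 53 2) mulrCA ler_peMr ?exprn_ge0 //; lra.
Qed.

Lemma golden_ratio_gt1 : 1 < phi.
Proof. by have := golden_ratio_ge; lra. Qed.

Let ln3_gt0 : 0 < ln (3 : R).
Proof. by rewrite ln_gt0 // ltr1n. Qed.

Lemma log3_golden_ratio_ge : 438 / 1000 <= log 3 phi.
Proof.
have p0 : 0 < phi by apply: lt_trans golden_ratio_gt1.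
rewrite /log ler_pdivlMr //.
have : ln (3 ^+ 53 : R) <= ln (phi ^+ 121).
  by rewrite ler_ln ?posrE ?exprn_gt0 // exp3_le_golden_ratio.
rewrite !lnXn ?ltr0n // -(mulr_natr (ln 3)) -(mulr_natr (ln phi)).
by move: (ln phi) (ln 3) ln3_gt0 => x y; lra.
Qed.

Lemma bigOmega_golden_ratio :
  [set f : nat -> R | f =Omega_\oo (fun n => n%:R `^ log 3 (golden_ratio R))]
    `<=` [set f : nat -> R | f =Omega_\oo (fun n : nat => n%:R `^ (438 / 1000) : R)].
Proof.
move=> f /= fg; apply: (eqOmega_trans fg).
rewrite eqOmegaE qualifE; apply/asboolP; exists 1 => //.
near=> n; rewrite mul1r !ger0_norm ?powR_ge0 // ler_powR ?log3_golden_ratio_ge //.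
by rewrite ler1n; near: n; exact: nbhs_infty_gt.
Unshelve. all: by end_near. Qed.

(** The node count is at most [3 ^ h], and raising [3 ^+ h] to the power [log 3 phi] gives
    [phi ^+ h]. *)
Lemma powR_size_le_golden_ratio h : ((3 ^ h).-1./2)%N%:R `^ log 3 phi <= phi ^+ h.
Proof.
have l0 : 0 <= log 3 phi.
  by rewrite divr_ge0 ?(ltW ln3_gt0) // ln_ge0 ?(ltW golden_ratio_gt1).
have -> : phi ^+ h = (3 ^+ h) `^ log 3 phi.
  have p0 : 0 < phi by apply: lt_trans golden_ratio_gt1.
  have h0 : 0 < (3 : R) ^+ h by rewrite exprn_gt0.
  apply: ln_inj; rewrite ?posrE ?exprn_gt0 ?powR_gt0 //.
  by rewrite ln_powR !lnXn // /log mulrnAr divfK // gt_eqF.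
rewrite ge0_ler_powR ?nnegrE ?ler0n ?exprn_ge0 // -natrX ler_nat.
by lia.
Qed.

End Golden.

(** * The lower bound for both sides *)

Theorem theorem6 (R : realType) :
  (exists2 k : R, 0 < k &
    forall h : nat, (1 <= h)%N ->
    forall D : node h -> int * int, orthogonal_drawing R D ->
      k * ((3 ^ h).-1./2)%N%:R `^ log 3 (golden_ratio R) <= (width R D)%:R /\
      k * ((3 ^ h).-1./2)%N%:R `^ log 3 (golden_ratio R) <= (height R D)%:R) /\
  [set f : nat -> R | f =Omega_\oo (fun n => n%:R `^ log 3 (golden_ratio R))]
    `<=` [set f : nat -> R | f =Omega_\oo (fun n : nat => n%:R `^ (438 / 1000) : R)].
Proof.
have p1 := golden_ratio_gt1 R.
have p0 : 0 < golden_ratio R := lt_trans ltr01 p1.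
split; last exact: bigOmega_golden_ratio.
(* For [h > 2], three factors cover the shift from [h] to [h - 3] and two come from
   [golden_ratio_exp_le_fib]. For [h <= 2] a positive width suffices, as [golden_ratio R ^+ h] is at
   most [golden_ratio R ^+ 5]. *)
exists (golden_ratio R ^- 5); first by rewrite invr_gt0 exprn_gt0.
move=> h h1 D /seq_drawing_grid gD.
have bound (E : node h -> int * int) : grid_drawing h (seq_drawing E) ->
    golden_ratio R ^- 5 * ((3 ^ h).-1./2)%N%:R `^ log 3 (golden_ratio R) <=
      (width R E)%:R.
  move=> gE; rewrite ler_pdivrMl ?exprn_gt0 //.
  apply: le_trans (powR_size_le_golden_ratio R h) _.
  have [h2|h2] := leqP h 2.
    apply: (@le_trans _ _ (golden_ratio R ^+ 5)).
      by rewrite ler_eXn2l // (leq_trans h2).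
    by rewrite ler_peMr ?exprn_ge0 ?(ltW p0) // ler1n width_gt0.
  have -> : golden_ratio R ^+ h =
      golden_ratio R ^+ 3 * golden_ratio R ^+ h.-2.-1.
    by rewrite -exprD; congr (_ ^+ _); lia.
  rewrite (exprD _ 3 2) -(mulrA _ _ (width R E)%:R) ler_pM2l ?exprn_gt0 //.
  apply: le_trans (golden_ratio_exp_le_fib R _) _.
  rewrite ler_pM2l ?exprn_gt0 // ler_nat.
  have -> : h.-2.-1.+1 = h.-2 by lia.
  exact: fib_le_width.
split; first exact: bound.
rewrite height_transpose; apply: bound.
exact: grid_drawing_transpose.
Qed.
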